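(* Let $\ell(t)$ and $\tilde\ell(t)$ be two fanning curves of $n$-dimensional subspaces of $\mathbb{R}^{2n}$, and let $\mathcal{A}(t)$ and $\mathcal{B}(t)$ be any normal frames spanning $\ell(t)$ and $\tilde\ell(t)$ respectively. Then $\ell(t)$ and $\tilde\ell(t)$ are congruent if and only if the Schwarzians of $\mathcal{A}(t)$ and $\mathcal{B}(t)$ are conjugate by a constant invertible matrix, i.e. there exists a constant invertible $n\times n$ matrix $X$ with $\{\mathcal{B}(t),t\}=X^{-1}\{\mathcal{A}(t),t\}X$ for all $t$.
   Context: A fanning frame is a smooth curve $\mathcal{A}(t)$, $t\in\mathbb{R}$, of real $2n\times n$ matrices such that the $2n\times 2n$ matrix $(\mathcal{A}(t)|\dot{\mathcal{A}}(t))$ obtained by juxtaposition is invertible for all $t$. A fanning curve is a smooth curve $\ell(t)$ of $n$-dimensional subspaces of $\mathbb{R}^{2n}$ that is the column span of a fanning frame. Two fanning curves $\ell(t),\tilde\ell(t)$ are congruent if there is an invertible linear transformation $\mathbf{T}$ of $\mathbb{R}^{2n}$ with $\tilde\ell(t)=\mathbf{T}\ell(t)$ for all $t$. For a fanning frame there are unique smooth curves of $n\times n$ matrices $P(t),Q(t)$ with $\ddot{\mathcal{A}}+\dot{\mathcal{A}}P(t)+\mathcal{A}Q(t)=O$; the Schwarzian of $\mathcal{A}(t)$ is $\{\mathcal{A}(t),t\}=2Q(t)-\tfrac12P(t)^2-\dot P(t)$. A fanning frame $\mathcal{A}(t)$ is normal if for all $t$ the columns of $\ddot{\mathcal{A}}(t)$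 are linear combinations of the columns of $\mathcal{A}(t)$ (i.e. $P(t)\equiv O$). *)

(* Defs.v *)
From mathcomp Require Import all_boot all_order all_algebra.
From mathcomp Require Import all_classical all_reals all_analysis.
Import Order.TTheory GRing.Theory Num.Theory.
Import numFieldNormedType.Exports.

Set Implicit Arguments.
Unset Strict Implicit.
Unset Printing Implicit Defensive.

Local Open Scope ring_scope.
Local Open Scope classical_set_scope.

(* In ring_scope these two notations otherwise denote the formal derivatives of
   a polynomial. *)
Local Notation "f ^` ()" := (derive1 f) : ring_scope.
Local Notation "f ^` ( k )" := (derive1n k f) : ring_scope.

(* R^(2n) is 'cV[R]_(n + n), so that the juxtaposition (A | A') of two
   2n x n matrices is the square matrix row_mx A A' : 'M[R]_(n + n). *)

Definition smooth (R : realType) (V : normedModType R) (f : R -> V) : Prop :=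
  forall (k : nat) (t : R), derivable (f^`(k)) t 1.

Definition colspan (R : realType) (m n : nat) (M : 'M[R]_(m, n)) :
    {vspace 'cV[R]_m} :=
  <<[tuple col j M | j < n]>>%VS.

Definition fanning_frame (R : realType) (n : nat)
    (A : R -> 'M[R]_(n + n, n)) : Prop :=
  smooth A /\ forall t, row_mx (A t) (A^`() t) \in unitmx.

(* Smoothness of l and \dim (l t) = n follow from the frame (for the latter,
   see fanning_curve_dim). *)
Definition fanning_curve (R : realType) (n : nat)
    (l : R -> {vspace 'cV[R]_(n + n)}) : Prop :=
  exists A : R -> 'M[R]_(n + n, n),
    fanning_frame A /\ forall t, l t = colspan (A t).

Definition congruent (R : realType) (n : nat)
    (l l' : R -> {vspace 'cV[R]_(n + n)}) : Prop :=
  exists T : 'End('cV[R]_(n + n)),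
    lker T == 0%VS /\ forall t, l' t = (T @: l t)%VS.

Definition normal_frame (R : realType) (n : nat)
    (A : R -> 'M[R]_(n + n, n)) : Prop :=
  fanning_frame A /\
  forall (t : R) (j : 'I_n), col j (A^`(2) t) \in colspan (A t).

(* The equation A'' + A' P + A Q = 0 reads (A | A') (Q ; P) = - A'', whence
   these formulas; see frame_coefP, frame_coef_uniq and smooth_frame_coef for
   existence, uniqueness and smoothness of P and Q. *)
Definition frame_coef (R : realType) (n : nat)
    (A : R -> 'M[R]_(n + n, n)) (t : R) : 'M[R]_(n + n, n) :=
  - (invmx (row_mx (A t) (A^`() t)) *m A^`(2) t).

Definition frameQ (R : realType) (n : nat)
    (A : R -> 'M[R]_(n + n, n)) (t : R) : 'M[R]_n :=
  usubmx (frame_coef A t).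

Definition frameP (R : realType) (n : nat)
    (A : R -> 'M[R]_(n + n, n)) (t : R) : 'M[R]_n :=
  dsubmx (frame_coef A t).

Definition schwarzian (R : realType) (n : nat)
    (A : R -> 'M[R]_(n + n, n)) (t : R) : 'M[R]_n :=
  2 *: frameQ A t - 2^-1 *: (frameP A t *m frameP A t) - (frameP A)^`() t.

Section frame_theory.
Variables (R : realType) (n : nat).
Implicit Types A : R -> 'M[R]_(n + n, n).

Lemma frame_coefP A t : fanning_frame A ->
  A^`(2) t + A^`() t *m frameP A t + A t *m frameQ A t = 0.
Proof.
move=> [_ uA]; rewrite -addrA [X in _ + X]addrC -mul_row_col vsubmxK.
by rewrite /frame_coef mulmxN mulmxA mulmxV// mul1mx subrr.
Qed.

Lemma frame_coef_uniq A t (P Q : 'M[R]_n) : fanning_frame A ->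
  A^`(2) t + A^`() t *m P + A t *m Q = 0 -> P = frameP A t /\ Q = frameQ A t.
Proof.
move=> [_ uA]; rewrite -addrA [X in _ + X]addrC -mul_row_col => E.
have {}E : col_mx Q P = frame_coef A t.
  rewrite /frame_coef -[LHS](mulKmx (uA t)) -mulmxN; congr (_ *m _).
  by apply/eqP; rewrite -addr_eq0 addrC E.
by rewrite /frameP /frameQ -E col_mxKu col_mxKd.
Qed.

Lemma mem_colspan (m p : nat) (M : 'M[R]_(m, p)) (v : 'cV[R]_m) :
  v \in colspan M <-> exists x : 'cV[R]_p, v = M *m x.
Proof.
have E (x : 'cV[R]_p) : M *m x = \sum_(j < p) x j 0 *: col j M.
  apply/colP => i; rewrite mxE summxE; apply: eq_bigr => j _.
  by rewrite !mxE mulrC.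
split=> [/coord_span ->|[x ->]].
  exists (\col_j coord [tuple col j M | j < p] j v).
  by rewrite E; apply: eq_bigr => j _; rewrite mxE -tnth_nth tnth_mktuple.
rewrite E; apply: memv_suml => j _; apply: memvZ; apply: memv_span.
by apply/mapP; exists j; rewrite ?mem_enum.
Qed.

Lemma normal_frameP A : fanning_frame A ->
  normal_frame A <-> forall t, frameP A t = 0.
Proof.
move=> fA; split=> [[_ NA] t|PA].
  have [X EX] : exists X : 'M[R]_n, A^`(2) t = A t *m X.
    have /choice[x Ex] : forall j, exists x : 'cV[R]_n,
        col j (A^`(2) t) = A t *m x by move=> j; apply/mem_colspan.
    exists (\matrix_(i, j) x j i 0); apply/matrixP => i j.
    have /colP/(_ i) := Ex j; rewrite !mxE => ->.
    by apply: eq_bigr => k _; rewrite mxE.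
  have [] := @frame_coef_uniq A t 0 (- X) fA; last by move=> <-.
  by rewrite EX mulmx0 addr0 mulmxN subrr.
split=> // t j; apply/mem_colspan; exists (- col j (frameQ A t)).
have /eqP := frame_coefP t fA.
rewrite PA mulmx0 addr0 addr_eq0 => /eqP ->.
by rewrite mulmxN; apply/colP => i; rewrite !mxE; under [in RHS]eq_bigr do rewrite mxE.
Qed.

Lemma fanning_curve_dim (l : R -> {vspace 'cV[R]_(n + n)}) t :
  fanning_curve l -> \dim (l t) = n.
Proof.
move=> [A [[_ uA] ->]]; rewrite /colspan; set X := mktuple _.
suff /eqP -> : free X by rewrite size_tuple.
apply/freeP => k kX i; pose x : 'cV[R]_n := \col_j k j.
have Ax : A t *m x = 0.
  apply/colP => r; rewrite -kX mxE summxE; apply: eq_bigr => j _.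
  by rewrite -tnth_nth tnth_mktuple !mxE mulrC.
have : col_mx x (0 : 'cV[R]_n) = 0.
  by rewrite -[LHS](mulKmx (uA t)) mul_row_col Ax mulmx0 addr0 mulmx0.
move=> /(congr1 usubmx); rewrite col_mxKu => /colP/(_ i).
by rewrite !mxE.
Qed.

End frame_theory.

Section smooth_theory.
Variable R : realType.
Implicit Types f g : R -> R.

Let Cn (k : nat) f := forall j t, (j < k)%N -> derivable (f^`(j)) t 1.

Let CnS k f : Cn k.+1 f <-> (forall t, derivable f t 1) /\ Cn k (f^`()).
Proof.
split=> [C|[C0 CS] [|j] t jk //]; last by rewrite derive1Sn; exact: CS.
split=> [t|j t jk]; first exact: (C 0%N).
by rewrite -derive1Sn; exact: C.
Qed.

Let CnW k f : Cn k.+1 f -> Cn k f.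
Proof. by move=> C j t jk; apply: C; rewrite ltnW. Qed.

Let smoothCn f : smooth f <-> forall k, Cn k f.
Proof. by split=> [C k j t _|C k t]; [exact: C|exact: (C k.+1)]. Qed.

Let CnD k f g : Cn k f -> Cn k g -> Cn k (f \+ g).
Proof.
elim: k f g => [|k IH] f g; first by move=> _ _ j t; rewrite ltn0.
move=> /CnS[f0 fS] /CnS[g0 gS]; apply/CnS; split.
  by move=> t; exact: derivableD.
rewrite (_ : _^`() = f^`() \+ g^`()); first exact: IH.
by apply/funext => t; rewrite !derive1E deriveD -?derive1E.
Qed.

Let CnM k f g : Cn k f -> Cn k g -> Cn k (f \* g).
Proof.
elim: k f g => [|k IH] f g; first by move=> _ _ j t; rewrite ltn0.
move=> fC gC.
have /CnS[f0 fS] := fC; have /CnS[g0 gS] := gC; apply/CnS; split.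
  by move=> t; exact: derivableM.
rewrite (_ : _^`() = (f \* g^`()) \+ (g \* f^`())).
  apply: CnD; apply: IH; [exact: CnW|exact: gS|exact: CnW|exact: fS].
by apply/funext => t; rewrite !derive1E deriveM -?derive1E.
Qed.

Let CnN k f : Cn k f -> Cn k (\- f).
Proof.
elim: k f => [|k IH] f; first by move=> _ j t; rewrite ltn0.
move=> /CnS[f0 fS]; apply/CnS; split.
  by move=> t; exact: derivableN.
rewrite (_ : _^`() = \- f^`()); first exact: IH.
by apply/funext => t; rewrite !derive1E deriveN -?derive1E.
Qed.

Let CnV k f : (forall t, f t != 0) -> Cn k f -> Cn k (fun t => (f t)^-1).
Proof.
move=> fn0; elim: k => [|k IH] fC; first by move=> j t; rewrite ltn0.
have /CnS[f0 fS] := fC; apply/CnS; split.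
  by move=> t; exact: derivableV.
rewrite (_ : _^`() =
    \- (((fun t => (f t)^-1) \* (fun t => (f t)^-1)) \* f^`())).
  apply/CnN/CnM; last exact: fS.
  by apply: CnM; exact/IH/CnW.
apply/funext => t; rewrite !derive1E deriveV // -derive1E.
by rewrite -exprVn expr2 /GRing.scale /= mulNr.
Qed.

Lemma smoothD f g : smooth f -> smooth g -> smooth (f \+ g).
Proof. by move=> /smoothCn fC /smoothCn gC; apply/smoothCn => k; exact: CnD. Qed.

Lemma smoothM f g : smooth f -> smooth g -> smooth (f \* g).
Proof. by move=> /smoothCn fC /smoothCn gC; apply/smoothCn => k; exact: CnM. Qed.

Lemma smoothN f : smooth f -> smooth (\- f).
Proof. by move=> /smoothCn fC; apply/smoothCn => k; exact: CnN. Qed.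

Lemma smoothV f : (forall t, f t != 0) -> smooth f -> smooth (fun t => (f t)^-1).
Proof. by move=> f0 /smoothCn fC; apply/smoothCn => k; exact: CnV. Qed.

Lemma smooth_cst (c : R) : smooth (fun=> c).
Proof.
move=> k t; suff [d ->] : exists d : R, (fun=> c)^`(k) = cst d :> (R -> R).
  exact: derivable_cst.
elim: k => [|k [d IH]]; first by exists c.
by exists 0; apply/funext => x; rewrite derive1nS IH derive1_cst.
Qed.

Lemma smooth_sum (I : Type) (s : seq I) (F : I -> R -> R) :
  (forall i, smooth (F i)) -> smooth (fun t => \sum_(i <- s) F i t).
Proof.
move=> FC; elim: s => [|i s IH].
  by under eq_fun do rewrite big_nil; exact: smooth_cst.
under eq_fun do rewrite big_cons; exact: (smoothD (FC i) IH).
Qed.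

Lemma smooth_prod (I : Type) (s : seq I) (F : I -> R -> R) :
  (forall i, smooth (F i)) -> smooth (fun t => \prod_(i <- s) F i t).
Proof.
move=> FC; elim: s => [|i s IH].
  by under eq_fun do rewrite big_nil; exact: smooth_cst.
under eq_fun do rewrite big_cons; exact: (smoothM (FC i) IH).
Qed.

Lemma smooth_derive1 (V : normedModType R) (f : R -> V) :
  smooth f -> smooth (f^`()).
Proof. by move=> fC k t; rewrite -derive1Sn; exact: fC. Qed.

Lemma smooth_mxP (m p : nat) (M : R -> 'M[R]_(m, p)) :
  smooth M <-> forall i j, smooth (fun t => M t i j).
Proof.
have E k : (forall l t, (l < k)%N -> derivable (M^`(l)) t 1) ->
    forall i j, (fun t => M t i j)^`(k) = (fun t => M^`(k) t i j).
  elim: k => [//|k IH] C i j; rewrite derive1nS IH; last first.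
    by move=> l t lk; apply: C; rewrite ltnW.
  by apply/funext => t; rewrite derive1nS !derive1E derive_mx ?mxE//; exact: C.
split=> [C i j k t|C k t].
  rewrite E; last by move=> l s _; exact: C.
  by have /derivable_mxP := C k t.
elim/ltn_ind: k t => k IH t; apply/derivable_mxP => i j.
by rewrite -E; [exact: C | move=> l s lk; exact: IH].
Qed.

Lemma smooth_mulmx (m p q : nat) (M : R -> 'M[R]_(m, p)) (N : R -> 'M[R]_(p, q)) :
  smooth M -> smooth N -> smooth (fun t => M t *m N t).
Proof.
move=> /smooth_mxP MC /smooth_mxP NC; apply/smooth_mxP => i j.
under eq_fun do rewrite mxE.
apply: smooth_sum => k; exact: (smoothM (MC i k) (NC k j)).
Qed.

Lemma smooth_det (p : nat) (M : R -> 'M[R]_p) :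
  smooth M -> smooth (fun t => \det (M t)).
Proof.
move=> /smooth_mxP MC; apply: smooth_sum => s; apply: smoothM.
  exact: smooth_cst.
by apply: smooth_prod => i; exact: MC.
Qed.

Lemma smooth_invmx (p : nat) (M : R -> 'M[R]_p) :
  (forall t, M t \in unitmx) -> smooth M -> smooth (fun t => invmx (M t)).
Proof.
move=> uM MC; apply/smooth_mxP => i j.
rewrite (_ : (fun t => _) =
    (fun t => (\det (M t))^-1) \* (fun t => cofactor (M t) j i)); last first.
  by apply/funext => t; rewrite /invmx uM !mxE.
apply: smoothM.
  apply: smoothV => [t|]; last exact: smooth_det.
  by rewrite -unitfE; exact: uM.
rewrite /cofactor; apply: smoothM; first exact: smooth_cst.
apply: smooth_det; apply/smooth_mxP => k l.
under eq_fun do rewrite !mxE; exact: ((smooth_mxP _).1 MC).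
Qed.

Lemma smooth_frame_coef (n : nat) (A : R -> 'M[R]_(n + n, n)) :
  fanning_frame A -> smooth (frameP A) /\ smooth (frameQ A).
Proof.
move=> [AC uA].
have AC1 := smooth_derive1 AC; have AC2 := smooth_derive1 AC1.
suff /smooth_mxP FC : smooth (frame_coef A).
  by split; apply/smooth_mxP => i j; under eq_fun do rewrite mxE;
    exact: (FC _ _).
apply/smooth_mxP => i j; under eq_fun do rewrite mxE.
apply: smoothN; move: i j; apply/smooth_mxP.
apply: smooth_mulmx AC2; apply: smooth_invmx uA _.
apply/smooth_mxP => i j; under eq_fun do rewrite mxE.
case: (fintype.split j) => k; [exact: ((smooth_mxP _).1 AC)|].
exact: ((smooth_mxP _).1 AC1).
Qed.

End smooth_theory.

(* Main.v *)
(* A normal frame satisfies A'' = - A Q with {A, t} = 2 Q.  If B = T A X with T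
   constant, then comparing T^-1 B'' = (A X)'' with the equation of B in the
   basis (A | A') gives 2 X' = 0 and then Q_A X = X Q_B.  Conversely, if
   Q_B = X^-1 Q_A X, then C = A X and B solve the same second-order linear
   equation, so the fundamental matrices (B | B') and (C | C') solve the same
   first-order one, and (B | B') (C | C')^-1 has zero derivative. *)
Require Import Defs.
From mathcomp Require Import all_boot all_order all_algebra.
From mathcomp Require Import all_classical all_reals all_analysis.
Import Order.TTheory GRing.Theory Num.Theory.
Import numFieldNormedType.Exports.

Local Open Scope ring_scope.

Set Implicit Arguments.
Unset Strict Implicit.

(** * Calculus of smooth matrix curves *)

Lemma smooth_derivable (R : realType) (V : normedModType R) (f : R -> V) (t : R) :
  smooth f -> derivable f t 1.
Proof. by move=> fC; exact: (fC 0%N). Qed.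

Lemma derive1_mxE (R : realType) (m p : nat) (M : R -> 'M[R]_(m, p)) (t : R) i j :
  smooth M -> derive1 M t i j = derive1 (fun s => M s i j) t.
Proof.
by move=> sM; rewrite !derive1E derive_mx ?mxE //; exact: smooth_derivable.
Qed.

Lemma derive1_mulmx (R : realType) (m p q : nat)
    (M : R -> 'M[R]_(m, p)) (N : R -> 'M[R]_(p, q)) (t : R) :
  smooth M -> smooth N ->
  derive1 (fun s => M s *m N s) t = derive1 M t *m N t + M t *m derive1 N t.
Proof.
move=> sM sN; apply/matrixP => i j.
have dM k : derivable (fun s => M s i k) t 1.
  exact/smooth_derivable/(smooth_mxP _).1.
have dN k : derivable (fun s => N s k j) t 1.
  exact/smooth_derivable/(smooth_mxP _).1.
rewrite (derive1_mxE _ _ _ (smooth_mulmx sM sN)) derive1E.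
have -> : (fun s => (M s *m N s) i j) =
    \sum_(k < p) ((fun s => M s i k) * (fun s => N s k j)).
  by apply/funext => s; rewrite fct_sumE mxE.
rewrite derive_sum => [|k]; last exact: derivableM.
rewrite !mxE -big_split /=; apply: eq_bigr => k _.
(* [deriveM] yields f g' + g f'; the sum is swapped, and the entries commuted, to match M' N + M
   N'. *)
rewrite deriveM // -!derive1E -!derive1_mxE // addrC; congr (_ + _).
by rewrite /GRing.scale /= mulrC.
Qed.

Lemma smooth_cst_mx (R : realType) (m p : nat) (M : 'M[R]_(m, p)) :
  smooth (fun _ : R => M).
Proof. by apply/smooth_mxP => i j; exact: smooth_cst. Qed.

Lemma derive1_mulmxl (R : realType) (m p q : nat) (M : 'M[R]_(m, p))
    (N : R -> 'M[R]_(p, q)) (t : R) :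
  smooth N -> derive1 (fun s => M *m N s) t = M *m derive1 N t.
Proof.
move=> sN; rewrite (derive1_mulmx _ (@smooth_cst_mx _ _ _ M) sN).
by rewrite derive1_cst mul0mx add0r.
Qed.

Lemma derive1_mulmxr (R : realType) (m p q : nat) (M : R -> 'M[R]_(m, p))
    (N : 'M[R]_(p, q)) (t : R) :
  smooth M -> derive1 (fun s => M s *m N) t = derive1 M t *m N.
Proof.
move=> sM; rewrite (derive1_mulmx _ sM (@smooth_cst_mx _ _ _ N)).
by rewrite derive1_cst mulmx0 addr0.
Qed.

Lemma derive1_mxD (R : realType) (m p : nat) (M N : R -> 'M[R]_(m, p)) (t : R) :
  smooth M -> smooth N ->
  derive1 (fun s => M s + N s) t = derive1 M t + derive1 N t.
Proof.
by move=> sM sN; rewrite !derive1E -deriveD //; exact: smooth_derivable.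
Qed.

Lemma smooth_row_mx (R : realType) (m p q : nat)
    (M : R -> 'M[R]_(m, p)) (N : R -> 'M[R]_(m, q)) :
  smooth M -> smooth N -> smooth (fun t => row_mx (M t) (N t)).
Proof.
move=> /smooth_mxP sM /smooth_mxP sN; apply/smooth_mxP => i j.
under eq_fun do rewrite mxE.
case: (fintype.split j) => k; [exact: sM|exact: sN].
Qed.

Lemma derive1_row_mx (R : realType) (m p q : nat)
    (M : R -> 'M[R]_(m, p)) (N : R -> 'M[R]_(m, q)) (t : R) :
  smooth M -> smooth N ->
  derive1 (fun s => row_mx (M s) (N s)) t = row_mx (derive1 M t) (derive1 N t).
Proof.
move=> sM sN; apply/matrixP => i j.
rewrite derive1_mxE; last exact: smooth_row_mx.
rewrite [RHS]mxE; under eq_fun do rewrite mxE.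
by case: (fintype.split j) => k; rewrite -derive1_mxE.
Qed.

(** Reduces entrywise to the scalar fact that a zero derivative on the whole line forces a
    constant. *)
Lemma derive1_mx0_cst (R : realType) (m p : nat) (M : R -> 'M[R]_(m, p)) :
  smooth M -> (forall t, derive1 M t = 0) -> forall s t, M s = M t.
Proof.
move=> sM M0 s t; apply/matrixP => i j.
apply: (is_derive_0_is_cst (f := fun u => M u i j)) => u.
apply: DeriveDef; first exact/smooth_derivable/(smooth_mxP _).1.
by rewrite -derive1E -derive1_mxE // M0 mxE.
Qed.

(** * Column spans and matrices of linear maps *)

Lemma sub_colspanP (R : realType) (m p q : nat) (M : 'M[R]_(m, p))
    (N : 'M[R]_(m, q)) :
  (colspan N <= colspan M)%VS <-> exists X : 'M[R]_(p, q), N = M *m X.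
Proof.
split=> [/subvP NM|[X ->]].
  have /choice[x Ex] : forall j, exists x : 'cV[R]_p, col j N = M *m x.
    move=> j; apply/mem_colspan/NM/mem_colspan.
    by exists (delta_mx j 0); rewrite colE.
  exists (\matrix_(i, j) x j i 0); apply/matrixP => i j.
  have /colP/(_ i) := Ex j; rewrite !mxE => ->.
  by apply: eq_bigr => k _; rewrite mxE.
apply/subvP => v /mem_colspan[x ->]; apply/mem_colspan.
by exists (X *m x); rewrite mulmxA.
Qed.

Lemma limg_colspan (R : realType) (m k p : nat) (T : 'Hom('cV[R]_m, 'cV[R]_k))
    (M : 'M[R]_(k, m)) (N : 'M[R]_(m, p)) :
  (forall v, T v = M *m v) -> (T @: colspan N)%VS = colspan (M *m N).
Proof.
move=> TM; apply/vspaceP => w; apply/idP/idP.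
  move=> /memv_imgP[v /mem_colspan[x ->] ->]; apply/mem_colspan.
  by exists x; rewrite TM mulmxA.
move=> /mem_colspan[x ->]; apply/memv_imgP; exists (N *m x).
  by apply/mem_colspan; exists x.
by rewrite TM mulmxA.
Qed.

Lemma lfun_mulmx (R : fieldType) (m k : nat) (T : 'Hom('cV[R]_m, 'cV[R]_k)) :
  exists M : 'M[R]_(k, m), forall v, T v = M *m v.
Proof.
(* [lin1_mx] represents maps of row vectors acting from the right, hence the conjugation by
   transposes. *)
exists (lin1_mx (trmx \o T \o trmx))^T => v.
by rewrite -[v in RHS]trmxK -trmx_mul mul_rV_lin1 /= !trmxK.
Qed.

(** Trades the endomorphism for a constant matrix, which can be multiplied into frames and
    differentiated. *)
Lemma congruent_mx (R : realType) (n : nat)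
    (l l' : R -> {vspace 'cV[R]_(n + n)}) (A B : R -> 'M[R]_(n + n, n)) :
  (forall t, l t = colspan (A t)) -> (forall t, l' t = colspan (B t)) ->
  congruent l l' <-> exists M : 'M[R]_(n + n), M \in unitmx /\
    forall t, colspan (B t) = colspan (M *m A t).
Proof.
move=> lA lB; split=> [[T [kT El]]|[M [uM EM]]].
  have [M EM] := lfun_mulmx T.
  have [N EN] := lfun_mulmx (T^-1)%VF.
  exists M; split; last by move=> t; rewrite -lB El lA (limg_colspan _ EM).
  have NM : N *m M = 1%:M.
    (* The columns of [N *m M] are the images of the standard basis vectors under the inverse of [T]
       composed with [T]. *)
    apply/trmx_inj/row_matrixP => i; rewrite -!tr_col !colE -mulmxA -EM -EN.
    by rewrite -comp_lfunE lker0_compVf // id_lfunE mul1mx.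
  by have [] := mulmx1_unit NM.
exists (linfun (mulmx M)).
have EL (v : 'cV_(n + n)) : linfun (mulmx M) v = M *m v by rewrite lfunE.
split; last by move=> t; rewrite lB lA (limg_colspan _ EL).
apply/lker0P => v w; rewrite !EL => /(congr1 (mulmx (invmx M))).
by rewrite !mulKmx.
Qed.

(** The columns of an invertible matrix are independent; this is how coefficients in the moving
    basis (A | A') are compared. *)
Lemma row_mx_unit_eq0 (R : comUnitRingType) (n p : nat) (A A' : 'M[R]_(n + n, n))
    (Y Z : 'M[R]_(n, p)) :
  row_mx A A' \in unitmx -> A *m Y + A' *m Z = 0 -> Y = 0 /\ Z = 0.
Proof.
move=> uA; rewrite -mul_row_col => /(congr1 (mulmx (invmx (row_mx A A')))).
by rewrite mulKmx // mulmx0 -col_mx0 => /eq_col_mx.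
Qed.

(** * Normal frames and their Schwarzians *)

Lemma normal_frame_derive2 (R : realType) (n : nat) (A : R -> 'M[R]_(n + n, n)) t :
  normal_frame A -> derive1 (derive1 A) t = - (A t *m frameQ A t).
Proof.
move=> hA; have fA := hA.1.
have /eqP := frame_coefP t fA.
by rewrite ((normal_frameP fA).1 hA) mulmx0 addr0 addr_eq0 => /eqP.
Qed.

Lemma schwarzian_normal (R : realType) (n : nat) (A : R -> 'M[R]_(n + n, n)) t :
  normal_frame A -> schwarzian A t = 2 *: frameQ A t.
Proof.
move=> hA; have P0 : frameP A = fun=> 0.
  by apply/funext; exact: (normal_frameP hA.1).1.
by rewrite /schwarzian P0 mulmx0 scaler0 subr0 derive1_cst subr0.
Qed.

(** Both Schwarzians equal 2 Q, and the factor 2 cancels. The intertwining form on the right avoids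
    inverses in later computations. *)
Lemma schwarzian_conj (R : realType) (n : nat) (A B : R -> 'M[R]_(n + n, n))
    (X : 'M[R]_n) t : normal_frame A -> normal_frame B -> X \in unitmx ->
  schwarzian B t = invmx X *m schwarzian A t *m X <->
  X *m frameQ B t = frameQ A t *m X.
Proof.
move=> hA hB uX; rewrite !schwarzian_normal // -scalemxAr -scalemxAl.
have n2 : (2 : R) != 0 by rewrite pnatr_eq0.
split=> [/(scalerI n2) ->|E]; first by rewrite -mulmxA mulKVmx.
by rewrite -mulmxA -E mulKmx.
Qed.

(** * From congruence to conjugate Schwarzians *)

Lemma normal_congruent_conj (R : realType) (n : nat)
    (A B : R -> 'M[R]_(n + n, n)) (M : 'M[R]_(n + n)) :
  normal_frame A -> normal_frame B -> M \in unitmx ->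
  (forall t, colspan (B t) = colspan (M *m A t)) ->
  exists X : 'M[R]_n, X \in unitmx /\
    forall t, X *m frameQ B t = frameQ A t *m X.
Proof.
move=> hA hB uM EM; have [[sA uA] _] := hA; have [[sB uB] _] := hB.
pose D t := invmx M *m B t.
have sD : smooth D by apply: smooth_mulmx sB; exact: smooth_cst_mx.
(* The A-coordinates of [D] in the basis (A | A'). A factor chosen pointwise from the inclusion of
   spans need not be smooth in t; this formula is. *)
pose X t := usubmx (invmx (row_mx (A t) (derive1 A t)) *m D t).
have sX : smooth X.
  apply/smooth_mxP => i j; under eq_fun do rewrite mxE.
  apply: (smooth_mxP _).1; apply: smooth_mulmx sD; apply: (smooth_invmx uA).
  exact: smooth_row_mx sA (smooth_derive1 sA).
have EX t : D t = A t *m X t.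
  have /sub_colspanP[Y EY] : (colspan (B t) <= colspan (M *m A t))%VS.
    by rewrite EM.
  have DY : D t = A t *m Y by rewrite /D EY -mulmxA mulKmx.
  suff -> : X t = Y by [].
  have E : A t *m Y = row_mx (A t) (derive1 A t) *m col_mx Y (0 : 'M[R]_n).
    by rewrite mul_row_col mulmx0 addr0.
  by rewrite /X DY E mulKmx // col_mxKu.
(* The reverse inclusion gives A = A X Y, and independence of the columns of A then gives X Y =
   1. *)
have uX t : X t \in unitmx.
  have /sub_colspanP[Y EY] : (colspan (M *m A t) <= colspan (B t))%VS.
    by rewrite EM.
  have EA : A t = A t *m (X t *m Y).
    by rewrite mulmxA -EX /D -mulmxA -EY mulKmx.
  have [] := @row_mx_unit_eq0 _ _ _ _ _ (X t *m Y - 1%:M) 0 (uA t).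
    by rewrite mulmxBr mulmx1 -EA subrr mulmx0 addr0.
  by move=> /eqP; rewrite subr_eq0 => /eqP /mulmx1_unit[].
have sA1 := smooth_derive1 sA; have sX1 := smooth_derive1 sX.
have D1 : derive1 D = fun t => derive1 A t *m X t + A t *m derive1 X t.
  rewrite (_ : D = fun t => A t *m X t); last exact/funext.
  by apply/funext => t; rewrite derive1_mulmx.
have D2 t : derive1 (derive1 D) t = - (A t *m X t *m frameQ B t).
  have -> : derive1 D = fun t => invmx M *m derive1 B t.
    by apply/funext => s; rewrite /D derive1_mulmxl.
  rewrite derive1_mulmxl; last exact: smooth_derive1.
  by rewrite normal_frame_derive2 // mulmxN mulmxA -/(D t) EX.
(* Expanding (A X)'' = A'' X + 2 A' X' + A X'' with A'' = - A Q_A and equating it to - A X Q_B; the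
   two equations are the coefficients of A and of A'. *)
have comp t : derive1 (derive1 X) t + (X t *m frameQ B t - frameQ A t *m X t) = 0
    /\ derive1 X t + derive1 X t = 0.
  apply: (row_mx_unit_eq0 (uA t)).
  have := D2 t; rewrite D1 derive1_mxD; do ?exact: smooth_mulmx.
  rewrite !derive1_mulmx // normal_frame_derive2 // => E.
  rewrite !mulmxDr mulmxN !mulmxA -[A t *m X t *m _]opprK -E mulNmx.
  (* With the products abstracted, only an identity in an abelian group remains. *)
  move: (A t *m _) (_ *m X t) (_ *m derive1 X t) => a q b.
  rewrite -opprD -[- q + b + _]addrA (addrC (- q)) subrK (addrA b).
  by rewrite (addrC _ a) addrAC subrr.
have X1 t : derive1 X t = 0.
  have [_ /eqP] := comp t.
  by rewrite -mulr2n -scaler_nat scaler_eq0 pnatr_eq0 => /eqP.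
have Xc := derive1_mx0_cst sX X1.
exists (X 0); split=> // t; have [/eqP E _] := comp t.
apply/eqP; rewrite -subr_eq0 (Xc 0 t); move: E.
by rewrite (_ : derive1 X = fun=> 0) ?derive1_cst ?add0r //; exact/funext.
Qed.

(** * From conjugate Schwarzians to congruence *)

Lemma linear_ode2_congruent (R : realType) (n : nat)
    (B C : R -> 'M[R]_(n + n, n)) (Q : R -> 'M[R]_n) :
  fanning_frame B -> fanning_frame C ->
  (forall t, derive1 (derive1 B) t = - (B t *m Q t)) ->
  (forall t, derive1 (derive1 C) t = - (C t *m Q t)) ->
  exists M : 'M[R]_(n + n), M \in unitmx /\ forall t, B t = M *m C t.
Proof.
move=> [sB uB] [sC uC] B2 C2.
pose W (A : R -> 'M[R]_(n + n, n)) t := row_mx (A t) (derive1 A t).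
have sW A : smooth A -> smooth (W A).
  by move=> sA; exact: smooth_row_mx sA (smooth_derive1 sA).
(* Companion matrix of Y'' = - Y Q, acting on the right: (Y | Y') K = (Y' | - Y Q). *)
pose K t : 'M[R]_(n + n) := block_mx 0 (- Q t) 1%:M 0.
have W1 A t : smooth A -> derive1 (derive1 A) t = - (A t *m Q t) ->
    derive1 (W A) t = W A t *m K t.
  move=> sA A2; rewrite (derive1_row_mx t sA (smooth_derive1 sA)).
  by rewrite A2 mul_row_block !mulmx0 mulmx1 add0r addr0 mulmxN.
pose T t := W B t *m invmx (W C t).
have sT : smooth T.
  by apply: smooth_mulmx; [exact: sW|apply: smooth_invmx => //; exact: sW].
have WT : W B = fun t => T t *m W C t.
  by apply/funext => t; rewrite /T mulmxKV //; exact: uC.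
have T1 t : derive1 T t = 0.
  (* Differentiating W_B = T W_C gives T' W_C + T W_C K = W_B K; the K terms cancel, and W_C is
     invertible. *)
  have := W1 B t sB (B2 t); rewrite {1}WT (derive1_mulmx t sT (sW C sC)).
  rewrite (W1 C) // mulmxA -[T t *m W C t]/((fun t => T t *m W C t) t) -WT.
  move=> /eqP; rewrite -subr_eq0 addrK => /eqP E.
  by rewrite -(mulmxK (uC t) (derive1 T t)) E mul0mx.
exists (T 0); split=> [|t]; first by rewrite unitmx_mul uB unitmx_inv; exact: uC.
rewrite (derive1_mx0_cst sT T1 0 t).
have : W B t = T t *m W C t by rewrite WT.
by rewrite mul_mx_row => /eq_row_mx[].
Qed.

Unset Implicit Arguments.

Theorem theorem1p7 (R : realType) (n : nat)
    (l l' : R -> {vspace 'cV[R]_(n + n)})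
    (hl : fanning_curve l) (hl' : fanning_curve l')
    (A B : R -> 'M[R]_(n + n, n))
    (hA : normal_frame A) (hB : normal_frame B)
    (lA : forall t, l t = colspan (A t))
    (l'B : forall t, l' t = colspan (B t)) :
  congruent l l' <->
  exists X : 'M[R]_n, X \in unitmx /\
    forall t, schwarzian B t = invmx X *m schwarzian A t *m X.
Proof.
rewrite (congruent_mx lA l'B); split=> [[M [uM EM]]|[X [uX EX]]].
  have [X [uX EX]] := normal_congruent_conj hA hB uM EM.
  by exists X; split=> // t; apply/schwarzian_conj.
have [[sA uA] _] := hA; have sA1 := smooth_derive1 sA.
(* [C] spans the same curve as [A], and since X is constant and Q_A X = X Q_B, it satisfies C'' = -
   C Q_B, the equation of [B]. *)
pose C t := A t *m X.
have sC : smooth C by apply: smooth_mulmx sA _; exact: smooth_cst_mx.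
have C1 : derive1 C = fun t => derive1 A t *m X.
  by apply/funext => t; rewrite derive1_mulmxr.
have fC : fanning_frame C.
  split=> // t; rewrite C1.
  have -> : row_mx (C t) (derive1 A t *m X) =
      row_mx (A t) (derive1 A t) *m block_mx X 0 0 X.
    by rewrite mul_row_block !mulmx0 addr0 add0r.
  by rewrite unitmx_mul uA unitmxE det_ublock unitrM -unitmxE uX.
have C2 t : derive1 (derive1 C) t = - (C t *m frameQ B t).
  rewrite C1 (derive1_mulmxr X t sA1) normal_frame_derive2 // mulNmx -!mulmxA.
  by rewrite ((schwarzian_conj t hA hB uX).1 (EX t)).
have [M [uM EM]] := linear_ode2_congruent hB.1 fC
  (fun t => normal_frame_derive2 t hB) C2.
(* Right multiplication by the invertible X leaves the column span of M A unchanged: X and its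
   inverse witness the two inclusions. *)
exists M; split=> // t; rewrite EM /C mulmxA; apply/eqP; rewrite eqEsubv.
apply/andP; split; apply/sub_colspanP; first by exists X.
by exists (invmx X); rewrite mulmxK.
Qed.
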